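(* Let $(M^7,g,\phi)$ be a $\mathrm{G}_2$-manifold with intrinsic endomorphism $S$ and 3-form $\Psi_\phi$. The intrinsic torsion of the $\mathrm{G}_2$-structure $\Psi_\phi$ is $$\Gamma=-\tfrac23\,S\lrcorner\Psi_\phi,$$ where $(S\lrcorner\Psi_\phi)(X,Y,Z):=\Psi_\phi(S(X),Y,Z)$.
   Context: Conventions. $(M^7,g)$ is an oriented Riemannian spin manifold with a unit section $\phi$ of its real rank-8 spinor bundle $\Sigma$ (Clifford algebra with $X^2=-|X|^2$; $e_1\cdots e_7=-\mathrm{Id}$ for positively oriented orthonormal frames), with inner product $(\cdot,\cdot)$ for which vectors act skew-symmetrically; Clifford multiplication is juxtaposition, forms act by $e_{i_1}\wedge\dots\wedge e_{i_k}\mapsto e_{i_1}\cdots e_{i_k}$. $\nabla$ is the Levi-Civita connection and its lift. $\Psi_\phi(X,Y,Z)=(XYZ\phi,\phi)$, and $S$ is the unique endomorphism field with $\nabla_X\phi=S(X)\phi$. Intrinsic torsion. Identify 2-forms with skew endomorphisms by $g(A(Y),Z)=\alpha(Y,Z)$, and let $\mathfrak{g}_2\subset\mathfrak{so}(7)\cong\Lambda^2$ be the stabiliser algebra of $\phi$, with orthogonal complement $\mathfrak{g}_2^\perp$. The intrinsic torsion $\Gamma$ is the unique section of $T^*M\otimes\mathfrak{g}_2^\perp$ such that $\nabla_XY-\Gamma(X)(Y)$ is a $\mathrm{G}_2$-connection, i.e. its spinor lift preserves $\phi$: $\nabla_X\phi=\frac12\Gamma(X)\phi$. It is viewed as a tensor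 $\Gamma(X,Y,Z)=g(\Gamma(X)(Y),Z)$. *)

(* Defs.v *)
From HB Require Import structures.
From mathcomp Require Import all_boot all_order all_algebra.
From mathcomp Require Import all_classical all_reals all_analysis.
Set Implicit Arguments.
Unset Strict Implicit.
Unset Printing Implicit Defensive.
Import Order.TTheory GRing.Theory Num.Theory.
Import numFieldNormedType.Exports.
Local Open Scope classical_set_scope.
Local Open Scope ring_scope.

(* C^k maps on an open subset A of R^7: all iterated directional derivatives
   of order at most k exist and are continuous on A. *)
Fixpoint Ck (R : realType) (W : normedModType R) (k : nat)
    (A : set 'rV[R]_7) (f : 'rV[R]_7 -> W) : Prop :=
  {within A, continuous f} /\
  if k is k'.+1 then
    forall v, (forall x, A x -> derivable f x v) /\
              Ck k' A (fun x => 'D_v f x)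
  else True.

Definition smooth (R : realType) (W : normedModType R)
    (A : set 'rV[R]_7) (f : 'rV[R]_7 -> W) : Prop :=
  forall k, Ck k A f.

Record chart (R : realType) (T : topologicalType) := Chart {
  chart_dom : set T;
  chart_map :> T -> 'rV[R]_7;
  chart_inv : 'rV[R]_7 -> T;
  chart_open : open chart_dom;
  chart_img_open : open (chart_map @` chart_dom);
  chartK : forall p, chart_dom p -> chart_inv (chart_map p) = p;
  chart_continuous : {within chart_dom, continuous chart_map};
  chart_inv_continuous :
    {within chart_map @` chart_dom, continuous chart_inv} }.

(* An oriented smooth 7-manifold, presented by a (not necessarily maximal)
   oriented atlas.  The atlas comes with a chosen chart around each point. *)
Record manifold (R : realType) := Manifold {
  mcarrier :> topologicalType;
  mhausdorff : hausdorff_space mcarrier;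
  msecond_countable : @second_countable mcarrier;
  atlas : set (chart R mcarrier);
  chart_at : mcarrier -> chart R mcarrier;
  chart_at_atlas : forall p, atlas (chart_at p);
  chart_at_dom : forall p, chart_dom (chart_at p) p;
  atlas_smooth : forall c c', atlas c -> atlas c' ->
    smooth (c @` (chart_dom c `&` chart_dom c')) (c' \o chart_inv c);
  atlas_oriented : forall c c', atlas c -> atlas c' ->
    forall p, chart_dom c p -> chart_dom c' p ->
    0 < \det ('J (c' \o chart_inv c) (c p)) }.

(* The tangent space at p is 'rV[R]_7: a tangent vector at p is given by its
   coordinates in the chosen chart chart_at p.  Accordingly, a vector field is
   a function M -> 'rV[R]_7, and an endomorphism A of T_pM is a matrix acting
   by v |-> v *m A. *)
Section Manifolds.
Context {R : realType} {M : manifold R}.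

Definition to_chart (c : chart R M) (p : M) (v : 'rV[R]_7) : 'rV[R]_7 :=
  v *m 'J (c \o chart_inv (chart_at p)) (chart_at p p).

Definition smooth_on (W : normedModType R) (U : set M) (f : M -> W) : Prop :=
  forall c, atlas c -> smooth (c @` (U `&` chart_dom c)) (f \o chart_inv c).

Definition smooth_field (U : set M) (X : M -> 'rV[R]_7) : Prop :=
  forall c, atlas c ->
    smooth (c @` (U `&` chart_dom c))
      ((fun p => to_chart c p (X p)) \o chart_inv c).

Definition dfun (W : normedModType R) (f : M -> W) (p : M) (v : 'rV[R]_7) : W :=
  'D_v (f \o chart_inv (chart_at p)) (chart_at p p).

Definition lie_bracket (X Y : M -> 'rV[R]_7) (p : M) : 'rV[R]_7 :=
  let coord Z := fun q => to_chart (chart_at p) q (Z q) in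
  dfun (coord Y) p (X p) - dfun (coord X) p (Y p).

End Manifolds.

Definition gram (R : realType) (G : 'M[R]_7) (v w : 'rV[R]_7) : R :=
  (v *m G *m w^T) 0 0.

Record riemannian_metric (R : realType) (M : manifold R) := RiemannianMetric {
  metric_mx : M -> 'M[R]_7;
  metric_sym : forall p, (metric_mx p)^T = metric_mx p;
  metric_pos : forall p v, v != 0 -> 0 < gram (metric_mx p) v v;
  metric_smooth : forall (U : set M) X Y, open U ->
    smooth_field U X -> smooth_field U Y ->
    smooth_on U (fun p => gram (metric_mx p) (X p) (Y p) : R^o) }.

Definition inner (R : realType) (M : manifold R) (g : riemannian_metric M)
    (p : M) (v w : 'rV[R]_7) : R := gram (metric_mx g p) v w.

Section LeviCivita.
Context {R : realType} {M : manifold R}.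

(* D p v Y is the covariant derivative (D_v Y)(p) of a local vector field Y
   in the direction v of T_pM; it is meaningful when Y is smooth near p. *)
Definition connection := M -> 'rV[R]_7 -> (M -> 'rV[R]_7) -> 'rV[R]_7.

Definition affine_connection (D : connection) : Prop :=
  forall U : set M, open U ->
  [/\ forall p Y, U p -> smooth_field U Y -> linear (fun v => D p v Y),
      forall p v Y Z, U p -> smooth_field U Y -> smooth_field U Z ->
        D p v (Y \+ Z) = D p v Y + D p v Z,
      forall p v (f : M -> R^o) Y, U p -> smooth_on U f -> smooth_field U Y ->
        D p v (fun q => (f q : R) *: Y q)
          = (dfun f p v : R) *: Y p + (f p : R) *: D p v Y
    & forall X Y, smooth_field U X -> smooth_field U Y ->
        smooth_field U (fun p => D p (X p) Y)].

Definition metric_connection (g : riemannian_metric M) (D : connection) :=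
  forall (U : set M) p v Y Z, open U -> U p ->
    smooth_field U Y -> smooth_field U Z ->
    dfun (fun q => inner g q (Y q) (Z q) : R^o) p v
      = inner g p (D p v Y) (Z p) + inner g p (Y p) (D p v Z).

Definition torsion_free (D : connection) : Prop :=
  forall (U : set M) p X Y, open U -> U p ->
    smooth_field U X -> smooth_field U Y ->
    D p (X p) Y - D p (Y p) X = lie_bracket X Y p.

Definition levi_civita (g : riemannian_metric M) (D : connection) : Prop :=
  [/\ affine_connection D, metric_connection g D & torsion_free D].

End LeviCivita.
Arguments connection {R} M.

(* A real representation on R^8 of the Clifford algebra of R^7, in which
   vectors act skew-symmetrically for the standard inner product of R^8. *)
Record clifford_rep (R : realType) := CliffordRep {
  gam :> 'I_7 -> 'M[R]_8;
  gam_rel : forall a b, gam a * gam b + gam b * gam a = (- 2 * (a == b)%:R)%:M;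
  gam_skew : forall a, (gam a)^T = - gam a;
  gam_vol : \prod_(a < 7) gam a = - 1%:M }.

(* Even products of unit vectors.  The even part of the Clifford algebra acts
   faithfully on R^8, so that Spin(7) is identified with its image. *)
Definition spin7 (R : realType) (c : clifford_rep R) (u : 'M[R]_8) : Prop :=
  exists s : seq 'rV[R]_7,
    [/\ ~~ odd (size s),
        (forall v, v \in s -> \sum_a v 0 a ^+ 2 = 1)
      & u = \prod_(v <- s) \sum_a v 0 a *: c a].

(* Spin structures are given by a Cech cocycle: local positively oriented
   orthonormal frames e_j, and a Spin(7)-valued cocycle h_jk lifting the
   SO(7)-valued cocycle of changes of frame (spin_lift). *)
Record spin_structure (R : realType) (M : manifold R)
    (g : riemannian_metric M) (c : clifford_rep R) := SpinStructure {
  spin_idx : Type;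
  spin_dom : spin_idx -> set M;
  spin_at : M -> spin_idx;
  spin_frame : spin_idx -> 'I_7 -> M -> 'rV[R]_7;
  spin_trans : spin_idx -> spin_idx -> M -> 'M[R]_8;
  spin_dom_open : forall j, open (spin_dom j);
  spin_at_dom : forall p, spin_dom (spin_at p) p;
  spin_frame_smooth : forall j a, smooth_field (spin_dom j) (spin_frame j a);
  spin_frame_orthonormal : forall j a b p, spin_dom j p ->
    inner g p (spin_frame j a p) (spin_frame j b p) = (a == b)%:R;
  spin_frame_oriented : forall j p, spin_dom j p ->
    0 < \det (\matrix_(a, i) spin_frame j a p 0 i);
  spin_trans_smooth : forall j k,
    smooth_on (spin_dom j `&` spin_dom k) (spin_trans j k);
  spin_trans_spin : forall j k p, spin_dom j p -> spin_dom k p ->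
    spin7 c (spin_trans j k p);
  spin_cocycle : forall j k l p, spin_dom j p -> spin_dom k p ->
    spin_dom l p ->
    spin_trans j k p * spin_trans k l p = spin_trans j l p;
  spin_lift : forall j k p (v : 'rV[R]_7), spin_dom j p -> spin_dom k p ->
    (\sum_a inner g p v (spin_frame j a p) *: c a) * spin_trans j k p
      = spin_trans j k p * (\sum_a inner g p v (spin_frame k a p) *: c a) }.

(* The spinor bundle is associated to the spin structure: its fibre at p is
   'cV[R]_8, where a spinor at p is given by its components with respect to
   the chosen frame spin_at p.  A spinor field is thus a function
   M -> 'cV[R]_8, and spinor_in j gives its components in the frame j. *)
Section Spinors.
Context {R : realType} {M : manifold R} {g : riemannian_metric M}.
Context {c : clifford_rep R} (P : spin_structure g c).

Definition frame_at (p : M) (a : 'I_7) : M -> 'rV[R]_7 :=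
  spin_frame (spin_at P p) a.

Definition clmul (p : M) (v : 'rV[R]_7) : 'M[R]_8 :=
  \sum_a inner g p v (frame_at p a p) *: c a.

Definition sdot (psi chi : 'cV[R]_8) : R := (psi^T *m chi) 0 0.

Definition spinor_in (j : spin_idx P) (psi : M -> 'cV[R]_8) (p : M) :=
  spin_trans j (spin_at P p) p *m psi p.

Definition smooth_spinor (psi : M -> 'cV[R]_8) : Prop :=
  forall j, smooth_on (spin_dom j) (spinor_in j psi).

Definition unit_spinor (phi : M -> 'cV[R]_8) : Prop :=
  smooth_spinor phi /\ forall p, sdot (phi p) (phi p) = 1.

(* Clifford action of the 2-form sum_(a<b) alpha_ab e_a /\ e_b, with
   components taken in an orthonormal frame. *)
Definition cl2 (alpha : 'M[R]_7) : 'M[R]_8 :=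
  \sum_(a < 7) \sum_(b < 7 | (a < b)%N) alpha a b *: (c a * c b).

(* The isomorphism so(7) -> spin(7) sends a skew endomorphism, identified
   with the 2-form alpha, to alpha / 2: whence the factor 1/2 in the local
   formula for the lift to spinors of a metric connection D, in which
   omega_ab = g(D_v e_a, e_b). *)
Definition spinor_lift (D : connection M) (p : M) (v : 'rV[R]_7)
    (psi : M -> 'cV[R]_8) : 'cV[R]_8 :=
  dfun (spinor_in (spin_at P p) psi) p v
  + 2^-1 *: (cl2 (\matrix_(a, b)
                    inner g p (D p v (frame_at p a)) (frame_at p b p))
             *m psi p).

Definition endo_field := M -> 'M[R]_7.

Definition smooth_endo (S : endo_field) : Prop :=
  forall (U : set M) X, open U ->
    smooth_field U X -> smooth_field U (fun p => X p *m S p).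

Definition intrinsic_endomorphism (nabla : connection M)
    (phi : M -> 'cV[R]_8) (S : endo_field) : Prop :=
  smooth_endo S /\
  forall p X, spinor_lift nabla p X phi = clmul p (X *m S p) *m phi p.

Definition Psi (phi : M -> 'cV[R]_8) (p : M) (X Y Z : 'rV[R]_7) : R :=
  sdot (clmul p X *m (clmul p Y *m (clmul p Z *m phi p))) (phi p).

Definition skew_endo (p : M) (A : 'M[R]_7) : Prop :=
  forall Y Z, inner g p (Y *m A) Z = - inner g p Y (Z *m A).

Definition two_form (p : M) (A : 'M[R]_7) : 'M[R]_7 :=
  \matrix_(a, b) inner g p (frame_at p a p *m A) (frame_at p b p).

Definition g2 (phi : M -> 'cV[R]_8) (p : M) (A : 'M[R]_7) : Prop :=
  skew_endo p A /\ (2^-1 *: cl2 (two_form p A)) *m phi p = 0.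

Definition so_inner (p : M) (A B : 'M[R]_7) : R :=
  \sum_(a < 7) \sum_(b < 7 | (a < b)%N) two_form p A a b * two_form p B a b.

Definition g2_perp (phi : M -> 'cV[R]_8) (p : M) (A : 'M[R]_7) : Prop :=
  skew_endo p A /\ forall B, g2 phi p B -> so_inner p A B = 0.

(* Gamma p X is the endomorphism Gamma(X) of T_pM. *)
Definition torsion_field := M -> {linear 'rV[R]_7 -> 'M[R]_7}.

Definition smooth_torsion (Gamma : torsion_field) : Prop :=
  forall (U : set M) X Y, open U -> smooth_field U X -> smooth_field U Y ->
    smooth_field U (fun p => Y p *m Gamma p (X p)).

Definition subtract_torsion (nabla : connection M) (Gamma : torsion_field)
  : connection M := fun p X Y => nabla p X Y - Y p *m Gamma p X.

Definition preserves (D : connection M) (phi : M -> 'cV[R]_8) : Prop :=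
  forall p X, spinor_lift D p X phi = 0.

Definition g2_connection (D : connection M) (phi : M -> 'cV[R]_8) : Prop :=
  [/\ affine_connection D, metric_connection g D & preserves D phi].

Definition intrinsic_torsion (nabla : connection M) (phi : M -> 'cV[R]_8)
    (Gamma : torsion_field) : Prop :=
  [/\ smooth_torsion Gamma,
      forall p X, g2_perp phi p (Gamma p X)
    & g2_connection (subtract_torsion nabla Gamma) phi].

Definition torsion_tensor (Gamma : torsion_field) (p : M)
    (X Y Z : 'rV[R]_7) : R := inner g p (Y *m Gamma p X) Z.

Definition endo_contract (S : endo_field)
    (T : M -> 'rV[R]_7 -> 'rV[R]_7 -> 'rV[R]_7 -> R) (p : M)
    (X Y Z : 'rV[R]_7) : R := T p (X *m S p) Y Z.

End Spinors.
Arguments endo_field {R} M.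
Arguments torsion_field {R} M.
Arguments torsion_tensor {R M} g Gamma p X Y Z.

(* Main.v *)
Require Import Defs.
From mathcomp Require Import all_boot all_order all_algebra.
From mathcomp Require Import ring lra.
From mathcomp Require Import all_classical all_reals all_analysis.
Import Order.TTheory GRing.Theory Num.Theory.
Local Open Scope ring_scope.

(* Comparing the two connections gives (1/2) Gamma(X) phi = S(X) phi, so with
   V = S(X) and beta = Psi(V, ., .) it suffices that beta lies in g2^perp and
   that beta acts on phi as -3 V.  The first holds because the inner product of
   beta with a 2-form w is (V w phi, phi).  For the second, phi and the
   e_a phi form an orthonormal basis of R^8, as do, for fixed a, e_a phi and
   the e_a e_b phi; summing the resolutions of the identity over a shows that
   the sum over a < b of the maps x |-> (x, e_a e_b phi) e_a e_b phi is 3 times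
   the projection onto the complement of phi.  Then Gamma(X) + (2/3) beta lies
   both in g2 and in g2^perp, hence vanishes. *)

(** * Sums over pairs of indices and matrix entries *)

Lemma sum_sym_lt (V : zmodType) n (F : 'I_n -> 'I_n -> V) :
  (forall a b, F a b = F b a) ->
  \sum_a \sum_b F a b = (\sum_(a < n) \sum_(b < n | (a < b)%N) F a b) *+ 2
                        + \sum_a F a a.
Proof.
move=> symF; rewrite mulr2n.
(* Exchanging the sums in one copy of the upper triangle turns it into the lower one, so each row
   splits into its entries above, below and on the diagonal. *)
rewrite [X in _ = _ + X + _](exchange_big_dep xpredT) //= -!big_split /=.
apply: eq_bigr => a _; rewrite (bigD1 a) //= addrC; congr (_ + _).
rewrite (bigID (fun b : 'I_n => (a < b)%N)) /=; congr (_ + _).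
  by apply: eq_bigl => b; rewrite -val_eqE /=; case: ltngtP.
apply: eq_big => [b|b _]; last exact: symF.
by rewrite -val_eqE /=; case: ltngtP.
Qed.

Lemma mulmx_tr_entry (R : pzSemiRingType) m n k (A : 'M[R]_(m, n))
    (B : 'M[R]_(k, n)) a b :
  (A *m B^T) a b = (row a A *m (row b B)^T) 0 0.
Proof. by rewrite !mxE; apply: eq_bigr => i _; rewrite !mxE. Qed.

(** * Clifford algebra acting on the spinors of R^8 *)

Section CliffordSpinor.
Context {R : realType} (c : clifford_rep R).
Implicit Types (V : 'M[R]_8) (phi x y : 'cV[R]_8) (w : 'M[R]_7).

Lemma gam_rel_mx a b :
  c a *m c b + c b *m c a = (- 2 * (a == b)%:R)%:M.
Proof. exact: (gam_rel c a b). Qed.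

Lemma gam_sq a : c a *m c a = - 1%:M.
Proof.
have n2 : (2 : R) != 0 by rewrite pnatr_eq0.
apply: (scalerI n2); rewrite scaler_nat mulr2n gam_rel_mx eqxx mulr1.
by rewrite -scalemx1 scaleNr scalerN.
Qed.

Lemma gam_anticomm a b : a != b -> c b *m c a = - (c a *m c b).
Proof.
move=> ab; have := gam_rel_mx a b.
by rewrite (negPf ab) mulr0 raddf0 => /eqP; rewrite addrC addr_eq0 => /eqP.
Qed.

Lemma sdotDl x x' y : sdot (x + x') y = sdot x y + sdot x' y.
Proof. by rewrite /sdot linearD mulmxDl mxE. Qed.

Lemma sdotZl k x y : sdot (k *: x) y = k * sdot x y.
Proof. by rewrite /sdot linearZ -scalemxAl mxE. Qed.

Lemma sdotNl x y : sdot (- x) y = - sdot x y.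
Proof. by rewrite -scaleN1r sdotZl mulN1r. Qed.

Lemma sdot0l y : sdot 0 y = 0.
Proof. by rewrite /sdot trmx0 mul0mx mxE. Qed.

Lemma sdot_suml I (r : seq I) (Q : pred I) (F : I -> 'cV[R]_8) y :
  sdot (\sum_(i <- r | Q i) F i) y = \sum_(i <- r | Q i) sdot (F i) y.
Proof.
by apply: (big_morph (sdot^~ y)) => [? ?|]; [exact: sdotDl | exact: sdot0l].
Qed.

Lemma sdotC x y : sdot x y = sdot y x.
Proof. by rewrite /sdot -[y in LHS]trmxK -trmx_mul mxE. Qed.

Lemma sdot_skew V x y : V^T = - V -> sdot (V *m x) y = - sdot x (V *m y).
Proof.
by move=> sV; rewrite /sdot trmx_mul sV mulmxN mulNmx mxE mulmxA.
Qed.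

Lemma sdot_skew0 V x : V^T = - V -> sdot (V *m x) x = 0.
Proof.
move=> sV; have /eqP := sdot_skew V x x sV.
by rewrite (sdotC x) -addr_eq0 -mulr2n mulrn_eq0 => /eqP.
Qed.

Lemma mul_outer x y : x *m x^T *m y = sdot x y *: x.
Proof. by rewrite -mulmxA [x^T *m y]mx11_scalar mul_mx_scalar. Qed.

(** Moving [c a] across the product leaves [- sdot phi (c a c b phi)]. For equal indices [c a]
    squares to -1; for distinct ones [c a *m c b] is itself skew, so the product vanishes. *)
Lemma sdot_gam phi a b :
  sdot phi phi = 1 -> sdot (c a *m phi) (c b *m phi) = (a == b)%:R.
Proof.
move=> phi1; rewrite -[sdot _ _]opprK -sdot_skew ?gam_skew //.
case: (eqVneq a b) => [<-|ab].
  by rewrite mulmxA gam_sq mulNmx mul1mx sdotNl phi1 opprK.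
have abT : (c a *m c b)^T = - (c a *m c b).
  by rewrite trmx_mul !gam_skew mulNmx mulmxN opprK (gam_anticomm a b ab).
by rewrite mulmxA (gam_anticomm a b ab) mulNmx sdotNl opprK sdot_skew0.
Qed.

Lemma gam_resolution phi : sdot phi phi = 1 ->
  phi *m phi^T + \sum_a (c a *m phi) *m (c a *m phi)^T = 1%:M.
Proof.
move=> phi1.
pose E := \matrix_(i < 8, a < 7) (c a *m phi) i 0.
have gamE a : c a *m phi = col a E by apply/colP => i; rewrite !mxE.
clearbody E.
have EE : E *m E^T = \sum_a (c a *m phi) *m (c a *m phi)^T.
  apply/matrixP => i j; rewrite summxE mxE; apply: eq_bigr => a _.
  by rewrite gamE !mxE big_ord1 !mxE.
(* The eight columns phi, e_a phi form a square matrix Q. Orthonormality says that Q^T Q = 1; the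
   resolution of the identity is Q Q^T = 1. *)
suff QQ : (row_mx phi E)^T *m row_mx phi E = 1%:M.
  rewrite -EE -mul_row_col -tr_row_mx.
  exact: (@mulmx1C R 8 (row_mx phi E)^T (row_mx phi E) QQ).
rewrite tr_row_mx mul_col_row.
have -> : phi^T *m phi = 1%:M by rewrite [LHS]mx11_scalar -/(sdot phi phi) phi1.
have phiE : phi^T *m E = 0.
  apply/rowP => a; rewrite [RHS]mxE -(sdot_skew0 (c a) phi (gam_skew c a)).
  by rewrite sdotC gamE /sdot !mxE; apply: eq_bigr => i _; rewrite !mxE.
have -> : E^T *m phi = 0.
  by rewrite -[LHS]trmxK trmx_mul trmxK phiE trmx0.
have -> : E^T *m E = 1%:M.
  apply/matrixP => a b; rewrite [RHS]mxE -(sdot_gam phi) // !gamE /sdot !mxE.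
  by apply: eq_bigr => i _; rewrite !mxE.
by rewrite phiE -scalar_mx_block.
Qed.

Lemma gam2_resolution phi : sdot phi phi = 1 ->
  \sum_(a < 7) \sum_(b < 7 | (a < b)%N)
     (c a *m (c b *m phi)) *m (c a *m (c b *m phi))^T
  = 3 *: (1%:M - phi *m phi^T).
Proof.
move=> phi1.
set F := fun a b : 'I_7 => (c a *m (c b *m phi)) *m (c a *m (c b *m phi))^T.
have symF a b : F a b = F b a.
  case: (eqVneq a b) => [->//|ab]; rewrite /F !mulmxA (gam_anticomm a b ab).
  by rewrite !mulNmx linearN /= mulmxN opprK.
have diagF a : F a a = phi *m phi^T.
  by rewrite /F !mulmxA gam_sq !mulNmx mul1mx linearN /= mulmxN opprK.
(* Conjugate the resolution of the identity by the orthogonal matrix [c a]. *)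
have rowF a : \sum_b F a b = 1%:M - (c a *m phi) *m (c a *m phi)^T.
  have /eqP := gam_resolution phi phi1; rewrite addrC eq_sym -subr_eq => /eqP h.
  transitivity (c a *m (\sum_b (c b *m phi) *m (c b *m phi)^T) *m (c a)^T).
    rewrite mulmx_sumr mulmx_suml; apply: eq_bigr => b _.
    by rewrite /F [(c a *m _)^T]trmx_mul !mulmxA.
  rewrite -h mulmxBr mulmxBl mulmx1 gam_skew mulmxN gam_sq opprK trmx_mul.
  by rewrite gam_skew !mulmxA.
(* With p = phi phi^T, the rows add up to 7 - (1 - p) = 6 + p and the diagonal to 7p. The difference
   6(1 - p) is twice the sum over a < b. *)
have := sum_sym_lt _ _ F symF.
rewrite (eq_bigr _ (fun a _ => rowF a)) sumrB (eq_bigr _ (fun a _ => diagF a)).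
rewrite !sumr_const card_ord.
have /eqP := gam_resolution phi phi1; rewrite addrC eq_sym -subr_eq => /eqP <-.
move=> /eqP; rewrite -subr_eq => /eqP h.
have n2 : (2 : R) != 0 by rewrite pnatr_eq0.
apply: (scalerI n2); rewrite [LHS]scaler_nat -/F -h scalerA -natrM scaler_nat.
by apply/matrixP => i j; rewrite !mxE; lra.
Qed.

(** When V is Clifford multiplication by a vector X, these are the components of the 2-form Psi(X,
    ., .) in the orthonormal frame. *)
Definition slant V phi : 'M[R]_7 :=
  \matrix_(a, b) sdot (V *m (c a *m (c b *m phi))) phi.

Lemma cl2_mulE w phi :
  @cl2 R c w *m phi =
  \sum_(a < 7) \sum_(b < 7 | (a < b)%N) w a b *: (c a *m (c b *m phi)).
Proof.
rewrite /cl2 mulmx_suml; apply: eq_bigr => a _; rewrite mulmx_suml.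
by apply: eq_bigr => b _; rewrite -scalemxAl -mulmxE mulmxA.
Qed.

Lemma cl2D w w' : @cl2 R c (w + w') = @cl2 R c w + @cl2 R c w'.
Proof.
rewrite /cl2 -big_split; apply: eq_bigr => a _ /=; rewrite -big_split.
by apply: eq_bigr => b _; rewrite mxE scalerDl.
Qed.

Lemma cl2Z k w : @cl2 R c (k *: w) = k *: @cl2 R c w.
Proof.
rewrite /cl2 scaler_sumr; apply: eq_bigr => a _; rewrite scaler_sumr.
by apply: eq_bigr => b _; rewrite mxE scalerA.
Qed.

(** Apply [gam2_resolution] to V phi, which is orthogonal to phi because V is skew. The sign comes
    from moving V across the inner product. *)
Lemma cl2_slant V phi : V^T = - V -> sdot phi phi = 1 ->
  @cl2 R c (slant V phi) *m phi = - 3 *: (V *m phi).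
Proof.
move=> sV phi1.
have := congr1 (mulmx^~ (V *m phi)) (gam2_resolution phi phi1).
rewrite -scalemxAl mulmxBl mul1mx mul_outer sdotC sdot_skew0 // scale0r subr0.
rewrite scaleNr => <-; rewrite cl2_mulE mulmx_suml -sumrN.
apply: eq_bigr => a _; rewrite mulmx_suml -sumrN; apply: eq_bigr => b _.
by rewrite mul_outer mxE sdot_skew // scaleNr.
Qed.

(** The symmetrised product of e_a and e_b is a scalar, and (V phi, phi) = 0. *)
Lemma slant_skew V phi : V^T = - V -> (slant V phi)^T = - slant V phi.
Proof.
move=> sV; apply/matrixP => a b; rewrite !mxE; apply/eqP.
rewrite -addr_eq0 -sdotDl -mulmxDr !mulmxA -mulmxDl gam_rel_mx.
by rewrite mul_scalar_mx -scalemxAr sdotZl sdot_skew0 // mulr0.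
Qed.

(** The 2-forms killing phi make up g2, so this places [slant V phi] in its orthogonal
    complement. *)
Lemma slant_orthogonal V phi w : @cl2 R c w *m phi = 0 ->
  \sum_(a < 7) \sum_(b < 7 | (a < b)%N) slant V phi a b * w a b = 0.
Proof.
move=> w0; transitivity (sdot (V *m (@cl2 R c w *m phi)) phi); last first.
  by rewrite w0 mulmx0 sdot0l.
rewrite cl2_mulE mulmx_sumr sdot_suml.
apply: eq_bigr => a _; rewrite mulmx_sumr sdot_suml; apply: eq_bigr => b _.
by rewrite -scalemxAr sdotZl mxE mulrC.
Qed.

Lemma skew_eq0 w : w^T = - w ->
  \sum_(a < 7) \sum_(b < 7 | (a < b)%N) w a b * w a b = 0 -> w = 0.
Proof.
move=> sw /eqP; rewrite psumr_eq0 => [/allP h|a _]; last first.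
  by apply: sumr_ge0 => b _; rewrite -expr2 sqr_ge0.
have lt0 (a b : 'I_7) : (a < b)%N -> w a b = 0.
  move=> ab; have := h a (mem_index_enum a); rewrite /= psumr_eq0 => [/allP k|i _].
    by have := k b (mem_index_enum b); rewrite ab mulf_eq0 orbb => /eqP.
  by rewrite -expr2 sqr_ge0.
have sw' a b : w a b = - w b a.
  by have /matrixP/(_ b a) := sw; rewrite !mxE.
apply/matrixP => a b; rewrite mxE; case: (ltngtP a b) => [/lt0//|/lt0 ba|/val_inj ->].
  by rewrite sw' ba oppr0.
by apply/eqP; have /eqP := sw' b b; rewrite -addr_eq0 -mulr2n mulrn_eq0.
Qed.

End CliffordSpinor.

(** * The orthonormal frame at a point: tangent endomorphisms as 2-forms *)

Section SpinFrame.
Context {R : realType} {M : manifold R} {g : riemannian_metric M}.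
Context {c : clifford_rep R} (P : spin_structure g c) (p : M).
Implicit Types (A w : 'M[R]_7) (v : 'rV[R]_7).

Local Notation G := (metric_mx g p).

Definition frame_mx : 'M[R]_7 := \matrix_a frame_at P p a p.

Local Notation F := frame_mx.

Lemma frame_mx_orthonormal : F *m G *m F^T = 1%:M.
Proof.
apply/matrixP => a b; rewrite [RHS]mxE.
rewrite -(spin_frame_orthonormal a b (spin_at_dom P p)) /inner /gram.
rewrite -![spin_frame _ _ _](rowK (fun a => frame_at P p a p)) -/F.
by rewrite mulmx_tr_entry !row_mul.
Qed.

Lemma frame_mx_dual : G *m F^T *m F = 1%:M.
Proof. by apply: mulmx1C; rewrite mulmxA frame_mx_orthonormal. Qed.

(** The matrix G F^T is the inverse of F, so this passes from chart coordinates to frame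
    coordinates. *)
Definition frame_coord v : 'rV[R]_7 := v *m G *m F^T.

Lemma frame_coordK v : frame_coord v *m F = v.
Proof. by rewrite /frame_coord -!mulmxA (mulmxA G) frame_mx_dual mulmx1. Qed.

Lemma frame_coordE v a : frame_coord v 0 a = inner g p v (frame_at P p a p).
Proof.
rewrite /frame_coord /inner /gram.
rewrite -[frame_at _ _ _ _](rowK (fun a => frame_at P p a p)).
by rewrite -/F mulmx_tr_entry row_id.
Qed.

Lemma two_formE A : two_form P p A = F *m A *m G *m F^T.
Proof.
apply/matrixP => a b; rewrite mxE -frame_coordE /frame_coord.
by rewrite -[frame_at _ _ _ _](rowK (fun a => frame_at P p a p)) -/F
           -!row_mul mxE.
Qed.

Lemma inner_two_form A (Y Z : 'rV[R]_7) :
  inner g p (Y *m A) Z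
  = (frame_coord Y *m two_form P p A *m (frame_coord Z)^T) 0 0.
Proof.
rewrite two_formE /inner /gram !mulmxA frame_coordK.
by rewrite -[in LHS](frame_coordK Z) trmx_mul !mulmxA.
Qed.

Lemma clmulE v : clmul P p v = \sum_a frame_coord v 0 a *: c a.
Proof. by apply: eq_bigr => a _; rewrite frame_coordE. Qed.

Lemma clmul_skew v : (clmul P p v)^T = - clmul P p v.
Proof.
rewrite /clmul raddf_sum -sumrN; apply: eq_bigr => a _ /=.
by rewrite linearZ /= gam_skew scalerN.
Qed.

Lemma Psi_slant (phi : M -> 'cV[R]_8) (X Y Z : 'rV[R]_7) :
  Psi P phi p X Y Z
  = (frame_coord Y *m slant c (clmul P p X) (phi p) *m (frame_coord Z)^T) 0 0.
Proof.
rewrite /Psi; move: (clmul P p X) => V.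
rewrite (clmulE Y) mulmx_suml mulmx_sumr sdot_suml.
rewrite -mulmxA mxE; apply: eq_bigr => a _.
rewrite -scalemxAl -scalemxAr sdotZl; congr (_ * _).
rewrite (clmulE Z) mulmx_suml !mulmx_sumr sdot_suml [RHS]mxE.
apply: eq_bigr => b _.
by rewrite -scalemxAl -!scalemxAr sdotZl !mxE mulrC.
Qed.

Lemma skew_two_form A :
  @skew_endo R M g p A -> (two_form P p A)^T = - two_form P p A.
Proof.
move=> sA; apply/matrixP => a b; rewrite !mxE sA; congr (- _).
rewrite /inner /gram -[in LHS](trmxK (_ *m _)) mxE !trmx_mul !trmxK.
by rewrite Defs.metric_sym mulmxA.
Qed.

(** Needed because [g2] consists of endomorphisms in chart coordinates, whereas w is given in the
    frame. The witness is F^-1 w F, with F^-1 = G F^T. *)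
Lemma two_form_surj w : w^T = - w ->
  exists2 A, @skew_endo R M g p A & two_form P p A = w.
Proof.
move=> sw; exists (G *m F^T *m w *m F).
  move=> Y Z; rewrite /inner /gram !trmx_mul !trmxK Defs.metric_sym sw.
  by rewrite !(mulNmx, mulmxN) [X in _ = - X]mxE opprK !mulmxA.
rewrite two_formE !mulmxA frame_mx_orthonormal mul1mx -!mulmxA (mulmxA F).
by rewrite frame_mx_orthonormal mulmx1.
Qed.

Lemma g2_perp_two_form (phi : M -> 'cV[R]_8) A (V : 'M[R]_8) :
  sdot (phi p) (phi p) = 1 -> g2_perp P phi p A -> V^T = - V ->
  (2^-1 *: @cl2 R c (two_form P p A)) *m phi p = V *m phi p ->
  two_form P p A = - (2 / 3) *: slant c V (phi p).
Proof.
move=> phi1 [sA perpA] sV AV; apply/eqP.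
rewrite scaleNr -addr_eq0; apply/eqP; set w := _ + _.
have sw : w^T = - w.
  by rewrite /w linearD linearZ /= skew_two_form // slant_skew // scalerN opprD.
have wphi : @cl2 R c w *m phi p = 0.
  (* The total coefficient of the action of [two_form P p A] on phi is 1 + (2/3)(-3)(1/2) = 0. *)
  rewrite cl2D cl2Z mulmxDl -scalemxAl cl2_slant // scalerA -AV.
  rewrite -scalemxAl scalerA -[X in X + _]scale1r -scalerDl.
  by apply/eqP; rewrite scaler_eq0; apply/orP; left; apply/eqP; field.
have [B sB Bw] := two_form_surj w sw.
have /perpA : g2 P phi p B.
  by split=> //; rewrite Bw -scalemxAl wphi scaler0.
rewrite /so_inner Bw => Aw.
have bw := slant_orthogonal c V _ _ wphi.
(* The squared norm of w is the pairing of w with A plus 2/3 of its pairing with the slant form;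
   [Aw] and [bw] make both vanish. *)
apply: skew_eq0 => //; rewrite -[RHS]addr0 -[X in _ + X](mulr0 (2 / 3)).
rewrite -[X in X + _]Aw -[X in _ * X]bw.
rewrite mulr_sumr -big_split; apply: eq_bigr => a _ /=.
rewrite mulr_sumr -big_split; apply: eq_bigr => b _ /=.
by rewrite [X in X * _]mxE [X in _ + X]mxE mulrDl mulrA.
Qed.

End SpinFrame.

(** * Comparison of the two connections *)

Theorem proposition4p4 (R : realType) (M : manifold R)
    (g : riemannian_metric M) (c : clifford_rep R) (P : spin_structure g c)
    (phi : M -> 'cV[R]_8) (hphi : unit_spinor P phi)
    (nabla : connection M) (hnabla : levi_civita g nabla)
    (S : endo_field M) (hS : intrinsic_endomorphism P nabla phi S)
    (Gamma : torsion_field M) (hGamma : intrinsic_torsion P nabla phi Gamma)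
    (p : M) (X Y Z : 'rV[R]_7) :
  torsion_tensor g Gamma p X Y Z
  = - (2 / 3) * endo_contract S (Psi P phi) p X Y Z.
Proof.
have [_ /(_ p) phi1] := hphi.
have [_ /(_ p X) nablaS] := hS.
have [_ /(_ p X) perpG [_ _ /(_ p X)]] := hGamma.
rewrite /spinor_lift /subtract_torsion.
set N := \matrix_(a, b) _.
have -> : N = \matrix_(a, b) inner g p (nabla p X (frame_at P p a))
                                       (frame_at P p b p)
              + (-1) *: two_form P p (Gamma p X).
  apply/matrixP => a b; rewrite !mxE /inner /gram !mulmxBl !mxE; ring.
(* Both lifts share the same derivative term, so they differ only by (1/2) Gamma(X) phi; since the
   modified lift kills phi, this equals the derivative of phi along X for [nabla]. *)
rewrite cl2D cl2Z mulmxDl scalerDr addrA scaleN1r mulNmx scalerN.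
move/eqP; rewrite subr_eq0 => /eqP; rewrite -[X in X = _]/(spinor_lift P nabla p X phi).
rewrite nablaS scalemxAl => /esym GS.
rewrite /torsion_tensor (inner_two_form P).
rewrite (g2_perp_two_form P p phi _ _ phi1 perpG (clmul_skew P p _) GS).
by rewrite /endo_contract Psi_slant -scalemxAr -scalemxAl mxE.
Qed.
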